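(* For all integers $t\ge 1$ and $\Delta\ge 1$, $h_t(\Delta)\le \frac{3}{2}\Delta^t+1$.
   Context: Graphs are finite and simple. The line graph $L(G)$ of a graph $G$ has the edges of $G$ as its vertices, two distinct edges being adjacent if they share an endpoint. The diameter of a graph is the maximum distance between two of its vertices (infinite if the graph is disconnected). For integers $t,\Delta\ge1$, $h_t(\Delta)$ is defined by the requirement that $h_t(\Delta)-1$ is the largest number of edges in a graph of maximum degree at most $\Delta$ whose line graph has diameter at most $t$. *)

(* Defs.v *)
From mathcomp Require Import all_boot.
From mathcomp Require Import boolp.

Set Implicit Arguments.
Unset Strict Implicit.
Unset Printing Implicit Defensive.

Record sgraph := SGraph {
  vertex :> finType;
  adj : rel vertex;
  adj_sym : symmetric adj;
  adj_irr : irreflexive adj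
}.

Definition edges (G : sgraph) : {set {set G}} :=
  [set [set x; y] | x : G, y : G in [set y | adj x y]].

Definition degree (G : sgraph) (x : G) : nat := #|[set y | adj x y]|.

Definition max_degree (G : sgraph) : nat := \max_(x : G) degree x.

(* Extended naturals, [None] being infinity. *)
Definition enat := option nat.

Definition emax (a b : enat) : enat :=
  if (a, b) is (Some m, Some n) then Some (maxn m n) else None.

Definition ele (a : enat) (n : nat) : bool :=
  if a is Some m then m <= n else false.

Definition walk (G : sgraph) (x y : G) (n : nat) : bool :=
  [exists p : n.-tuple G, path (@adj G) x p && (last x p == y)].

Definition dist (G : sgraph) (x y : G) : enat :=
  if pselect (exists n, walk x y n) is left ex then Some (ex_minn ex) else None.

(* The unit [Some 0] makes the diameter of the graph without vertices 0; this is
   immaterial for [h t D] when 0 < D, a single edge being then admissible. *)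
Definition diameter (G : sgraph) : enat :=
  \big[emax/Some 0]_(x : G) \big[emax/Some 0]_(y : G) dist x y.

Section LineGraph.
Variable G : sgraph.

Definition edge : finType := {e : {set G} | e \in edges G}.

Definition line_adj : rel edge :=
  fun e f => (e != f) && (val e :&: val f != set0).

Lemma line_adj_sym : symmetric line_adj.
Proof. by move=> e f; rewrite /line_adj eq_sym setIC. Qed.

Lemma line_adj_irr : irreflexive line_adj.
Proof. by move=> e; rewrite /line_adj eqxx. Qed.

Definition line_graph : sgraph := SGraph line_adj_sym line_adj_irr.

End LineGraph.

Definition admissible (t D : nat) (G : sgraph) : bool :=
  (max_degree G <= D) && ele (diameter (line_graph G)) t.

Definition edge_count (t D : nat) : pred nat :=
  fun m => `[< exists G : sgraph, admissible t D G /\ #|edges G| = m >].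

(* For [h] to be defined, the edge counts of admissible graphs must be bounded:
   line graphs have degree at most 2D, which bounds their balls of radius t. *)

Lemma ele_emax (a b : enat) n : ele (emax a b) n = ele a n && ele b n.
Proof.
by case: a => [a|//]; case: b => [b|] /=; rewrite ?geq_max ?andbF.
Qed.

Lemma ele_bigmax (I : finType) (F : I -> enat) n :
  ele (\big[emax/Some 0]_i F i) n = [forall i, ele (F i) n].
Proof.
have -> : ele (\big[emax/Some 0]_i F i) n = \big[andb/true]_i ele (F i) n.
  by apply: (big_morph (fun a => ele a n)) => // a b; exact: ele_emax.
by rewrite big_andE.
Qed.

Lemma ele_diameterP (G : sgraph) n :
  reflect (forall x y : G, ele (dist x y) n) (ele (diameter G) n).
Proof.
rewrite /diameter ele_bigmax.
apply: (iffP forallP) => [H x y|H x].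
  by have := H x; rewrite ele_bigmax => /forallP.
by rewrite ele_bigmax; apply/forallP.
Qed.

Lemma ele_distP (G : sgraph) (x y : G) n :
  reflect (exists2 k, k <= n & walk x y k) (ele (dist x y) n).
Proof.
rewrite /dist; case: pselect => [ex|nex] /=; last first.
  by apply: ReflectF => -[k _ w]; apply: nex; exists k.
case: ex_minnP => m wm minm; apply: (iffP idP) => [le_mn|[k le_kn /minm le_mk]].
  by exists m.
exact: leq_trans le_mk le_kn.
Qed.

Lemma walkS (G : sgraph) (x y : G) n :
  walk x y n.+1 = [exists z, adj x z && walk z y n].
Proof.
apply/existsP/existsP => [[p]|[z /andP[xz /existsP[p /andP[zp lp]]]]].
  case/tupleP: p => z p /= /andP[/andP[xz zp] lp].
  by exists z; rewrite xz; apply/existsP; exists p; rewrite zp.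
by exists [tuple of z :: p] => /=; rewrite xz zp.
Qed.

Lemma leq_card_bigcup (I T : finType) (P : pred I) (F : I -> {set T}) :
  #|\bigcup_(i | P i) F i| <= \sum_(i | P i) #|F i|.
Proof.
elim/big_rec2: _ => [|i m A _ le_Am]; first by rewrite cards0.
by rewrite (leq_trans (leq_card_setU _ _)) // leq_add2l.
Qed.

Lemma card_walk (G : sgraph) d n (x : G) :
  (forall z : G, degree z <= d) -> #|[set y | walk x y n]| <= d ^ n.
Proof.
move=> dP; elim: n x => [|n IHn] x.
  rewrite expn0 -(cards1 x); apply/subset_leq_card/subsetP => y.
  rewrite !inE => /existsP[p]; rewrite (tuple0 p) /= => /eqP->.
  exact: eqxx.
have -> : [set y | walk x y n.+1] =
    \bigcup_(z in [set z | adj x z]) [set y | walk z y n].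
  apply/setP => y; rewrite inE walkS.
  apply/existsP/bigcupP => [[z /andP[xz w]]|[z]].
    by exists z; rewrite inE.
  by rewrite !inE => xz w; exists z; rewrite xz.
apply: leq_trans (leq_card_bigcup _ _) _.
apply: (@leq_trans (\sum_(z in [set z | adj x z]) d ^ n)).
  by apply: leq_sum => z _; exact: IHn.
by rewrite sum_nat_const expnS leq_mul2r dP orbT.
Qed.

Lemma card_line (G : sgraph) : #|line_graph G| = #|edges G|.
Proof. by rewrite card_sig; apply: eq_card. Qed.

Lemma degree_line (G : sgraph) D (e : line_graph G) :
  max_degree G <= D -> degree e <= D.*2.
Proof.
move=> /bigmax_leqP degD.
case: e => e He; case/imset2P: (He) => x y _; rewrite inE => xy De.
pose star (z : G) := [set [set z; w] | w in [set w | adj z w]].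
have starD z : #|star z| <= D by apply: leq_trans (leq_imset_card _ _) (degD z _).
rewrite -addnn; apply: leq_trans (leq_add (starD x) (starD y)).
apply: leq_trans (leq_card_setU _ _).
rewrite /degree -(card_imset _ val_inj); apply/subset_leq_card/subsetP => f.
case/imsetP => -[g Hg]; rewrite inE => /andP[_ /= /set0Pn[z]].
rewrite De !inE => /andP[zxy zg] ->.
have gz : g \in star z.
  case/imset2P: Hg => a b _; rewrite inE => ab Dg; move: zg; rewrite Dg !inE.
  case/orP => /eqP->; apply/imsetP.
    by exists b; rewrite ?inE.
  by exists a; rewrite ?inE 1?adj_sym // setUC.
by case/orP: zxy => /eqP zE; rewrite -zE gz ?orbT.
Qed.

Lemma edge_count_ex t D : exists m, edge_count t D m.
Proof.
pose r : rel unit := fun _ _ => false.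
have rs : symmetric r by [].
have ri : irreflexive r by [].
have E0 : edges (SGraph rs ri) = set0.
  by apply/setP => e; rewrite inE; apply/imset2P => -[x y]; rewrite !inE.
exists 0; apply/asboolP; exists (SGraph rs ri); rewrite E0 cards0; split=> //.
apply/andP; split.
  apply/bigmax_leqP => x _; rewrite /degree eq_card0 // => y.
  by rewrite inE.
apply/ele_diameterP => -[e He].
by exfalso; move: (He); rewrite E0 inE.
Qed.

Lemma edge_count_bound t D m :
  edge_count t D m -> m <= \sum_(k < t.+1) D.*2 ^ k.
Proof.
move=> /asboolP[G [/andP[degD /ele_diameterP diam] <-]].
rewrite -card_line.
have [e _|E0] := pickP (fun e : line_graph G => true); last first.
  by rewrite (eq_card0 E0).
have UE : \bigcup_(k < t.+1) [set f : line_graph G | walk e f k] = setT.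
  apply/setP => f; rewrite inE; apply/bigcupP.
  have /ele_distP[k le_kt w] := diam e f.
  by exists (Ordinal (le_kt : k < t.+1)); rewrite ?inE.
rewrite -(cardsT (line_graph G)) -UE.
apply: leq_trans (leq_card_bigcup _ _) _; apply: leq_sum => k _.
by apply: card_walk => f; exact: degree_line.
Qed.

Definition h (t D : nat) : nat :=
  (ex_maxn (edge_count_ex t D) (@edge_count_bound t D)).+1.

Lemma h_spec t D :
  (exists G, admissible t D G /\ #|edges G| = (h t D).-1) /\
  (forall G, admissible t D G -> #|edges G| <= (h t D).-1).
Proof.
rewrite /h /=; case: ex_maxnP => m /asboolP hm maxm; split=> // G HG.
by apply: maxm; apply/asboolP; exists G.
Qed.

(* Main.v *)
Require Import Defs.
From mathcomp Require Import all_boot all_order all_algebra.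
From mathcomp Require Import zify ring lra.

Set Implicit Arguments.
Unset Strict Implicit.
Unset Printing Implicit Defensive.

Import Order.TTheory GRing.Theory Num.Theory.
Local Open Scope ring_scope.

(** Fix a vertex [v] of maximum degree [d] and sort the vertices by their distance to [v];
    let [T_i] be the number of geodesics from [v] to level [i], [U_i] the number of edges
    from level [i] to level [i + 1], and [I_i] the number of arcs inside level [i].
    Since every vertex of a positive level has a neighbour one level below,
    [I_i + T_(i+1) <= (d - 1) T_i], while [U_i <= T_(i+1)]; hence the edges not going
    beyond level [t - 1], plus [T_t], number at most [d ^ t].

    It remains to bound [U_(t-1)] plus the number of edges [xy] avoiding the levels below
    [t] by [3/2 T_t].  The diameter condition applied to [xy] and to the edges [vu] shows
    that [x] and [y] together reach all neighbours [u] of [v] within [t - 1] steps, so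
    that at least [d] geodesics of length [t] end in [x] or [y].  If [p] geodesics end in
    [x], coming from [b <= p] neighbours, give each edge leaving [x] upwards or sideways
    the weight [(3/2 p - b) / (d - b)].  At [x] these weights add up to at most
    [3/2 p - b], and every edge [xy] receives at least 1 from its two ends. *)

(** * Edges, degree sums and walks in the line graph *)

Section Edges.
Local Open Scope nat_scope.

Lemma adj_neq (G : sgraph) (x y : G) : adj x y -> x != y.
Proof. by apply: contraL => /eqP->; rewrite adj_irr. Qed.

Lemma edgesP (G : sgraph) (e : {set G}) :
  reflect (exists x y : G, adj x y /\ e = [set x; y]) (e \in edges G).
Proof.
apply: (iffP imset2P) => [[x y _]|[x [y [xy ->]]]].
  by rewrite inE => xy ->; exists x, y.
by exists x y; rewrite ?inE.
Qed.

Lemma edge_adj (G : sgraph) (e : {set G}) (x y : G) :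
  e \in edges G -> x \in e -> y \in e -> x != y -> adj x y.
Proof.
case/edgesP=> a [b [ab ->]]; rewrite !inE.
by move=> /orP[]/eqP-> /orP[]/eqP->; rewrite ?eqxx // adj_sym.
Qed.

Lemma sum_degree (G : sgraph) :
  \sum_(x : G) degree x = #|edges G|.*2.
Proof.
have cardE e : e \in edges G -> #|e| = 2.
  by case/edgesP=> x [y [/adj_neq xy ->]]; rewrite cards2 xy.
have degE (x : G) : degree x = \sum_(e in edges G) (x \in e).
  rewrite -big_mkcondr sum1dep_card /degree.
  rewrite -(card_in_imset (f := fun y => [set x; y])) /=.
    apply: eq_card => e; rewrite !inE; apply/imsetP/andP.
      case=> y; rewrite inE => xy ->; split; last by rewrite !inE eqxx.
      by apply/edgesP; exists x, y.
    case=> /edgesP[a [b [ab ->]]]; rewrite !inE => /orP[]/eqP->.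
      by exists b; rewrite ?inE.
    by exists a; rewrite ?inE 1?adj_sym // setUC.
  move=> y z; rewrite !inE => xy xz /setP/(_ y).
  by rewrite !inE eqxx orbT eq_sym (negbTE (adj_neq xy)) => /esym/eqP.
under eq_bigr do rewrite degE.
rewrite exchange_big /= (eq_bigr (fun=> 2)); last first.
  by move=> e /cardE <-; rewrite -big_mkcond sum1_card.
by rewrite sum_nat_const muln2.
Qed.

(** The walk runs through the vertices shared by consecutive edges: two successive ones lie on a
    common edge, so they are equal or adjacent. The [k.+1] shared vertices give at most [k]
    steps. *)
Lemma line_walk_walk (G : sgraph) (e f : line_graph G) k :
  walk e f k.+1 ->
  exists j a b, [/\ j <= k, a \in val e, b \in val f & walk a b j].
Proof.
elim: k e => [|k IHk] e; rewrite walkS => /existsP[e' /andP[/andP[_]]].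
  move=> /set0Pn[a /setIP[ae ae']] /existsP[p].
  rewrite (tuple0 p) /= => /eqP ff; exists 0, a, a; split=> //.
    by rewrite -ff.
  by apply/existsP; exists [tuple]; rewrite /=.
move=> /set0Pn[w /setIP[we we']] /IHk[j [a [b [jk ae' bf ab]]]].
have [wa|wa] := eqVneq w a.
  by exists j, a, b; rewrite -{1}wa; split=> //; apply: leqW.
exists j.+1, w, b; split=> //; rewrite walkS; apply/existsP; exists a.
by rewrite ab (edge_adj (valP e')).
Qed.

End Edges.

(** * The inequality for the two weights of an edge *)

Section Weights.
Variable F : realFieldType.
Implicit Types b c d p q : F.

Lemma weight_ge1 b d p : b < d -> 2 * d <= 3 * p -> 1 <= (3 / 2 * p - b) / (d - b).
Proof. by move=> bd dp; rewrite ler_pdivlMr; lra. Qed.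

Lemma weight_ge0 b d p : 0 <= b -> b <= p -> b < d -> 0 <= (3 / 2 * p - b) / (d - b).
Proof. by move=> b0 bp bd; apply: divr_ge0; lra. Qed.

(** For [3 * p < 2 * d] the weight decreases in [b], so on [b <= p] it is least at [b = p]. *)
Lemma weight_ge b d p : 0 <= b -> b <= p -> b < d -> 3 * p < 2 * d ->
  p / (2 * (d - p)) <= (3 / 2 * p - b) / (d - b).
Proof.
move=> b0 bp bd pd.
rewrite ler_pdivlMr; last lra.
rewrite mulrAC ler_pdivrMr; last lra.
have : 0 <= (p - b) * (2 * d - 3 * p) by apply: mulr_ge0; lra.
lra.
Qed.

Lemma weight_sum b c d p q : b <= p -> 0 <= b -> b < d -> c <= q -> 0 <= c -> c < d ->
  d <= p + q -> 1 <= (3 / 2 * p - b) / (d - b) + (3 / 2 * q - c) / (d - c).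
Proof.
move=> bp b0 bd cq c0 cd dpq.
have wp := weight_ge0 b0 bp bd; have wq := weight_ge0 c0 cq cd.
have [dp|pd] := leP (2 * d) (3 * p); first by have := weight_ge1 bd dp; lra.
have [dq|qd] := leP (2 * d) (3 * q); first by have := weight_ge1 cd dq; lra.
(* Both [p] and [q] are now below two thirds of [d], so each weight may be replaced by its least
   value. *)
apply: le_trans (lerD (weight_ge b0 bp bd pd) (weight_ge c0 cq cd qd)).
rewrite addf_div; [|lra|lra].
rewrite ler_pdivlMr; last by apply: mulr_gt0; lra.
rewrite mul1r.
(* With [x = d - p] and [y = d - q], this is [2xy <= x^2 + y^2]. *)
have : 0 <= (p - q) ^+ 2 by exact: sqr_ge0.
nra.
Qed.

End Weights.

(** * Geodesics from [v] and counting by levels *)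

Section Levels.
Local Open Scope nat_scope.
Variables (G : sgraph) (v : G) (t : nat).

Fixpoint nwalks (i : nat) (x : G) : nat :=
  if i is i'.+1 then \sum_(y | adj x y) nwalks i' y else x == v.

(** Extending by the edge from [u] to [v] gives walks to [v] that differ in their last vertex before
    [v]. *)
Lemma card_walk_nwalks (x : G) i :
  #|[set u | adj v u && walk x u i]| <= nwalks i.+1 x.
Proof.
elim: i x => [|i IHi] x.
  rewrite /= -big_mkcondr sum1dep_card.
  have -> : #|[set i | adj x i & i == v]| = adj x v.
    case: (boolP (adj x v)) => xv.
      rewrite (_ : [set i | _] = [set v]) ?cards1 //; apply/setP => i.
      by rewrite !inE; case: eqP => [->|]; rewrite ?xv ?andbF.
    apply/eqP; rewrite cards_eq0; apply/eqP/setP => i.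
    by rewrite !inE; case: eqP => [->|]; rewrite ?(negbTE xv) ?andbF.
  case: (boolP (adj x v)) => xv /=.
    rewrite -(cards1 x); apply/subset_leq_card/subsetP => u; rewrite !inE.
    by case/andP=> _ /existsP[p]; rewrite (tuple0 p) /= eq_sym.
  rewrite leqn0 cards_eq0; apply/eqP/setP => u; rewrite !inE.
  apply/negbTE/negP => /andP[vu /existsP[p]]; rewrite (tuple0 p) /= => /eqP xu.
  by rewrite adj_sym xu vu in xv.
apply: (@leq_trans (\sum_(y | adj x y) #|[set u | adj v u && walk y u i]|)).
  apply: leq_trans (leq_card_bigcup _ _); apply/subset_leq_card/subsetP => u.
  rewrite inE walkS => /andP[vu /existsP[z /andP[xz zu]]].
  by apply/bigcupP; exists z; rewrite // inE vu.
by apply: leq_sum => y _; apply: IHi.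
Qed.

(* Distance to [v], capped at [t.+1]. *)
Definition level (x : G) : nat :=
  find (fun i => 0 < nwalks i x) (iota 0 t.+1).

Lemma level_max x : level x <= t.+1.
Proof. by rewrite /level -{2}(size_iota 0 t.+1) find_size. Qed.

Lemma level_leq x i : 0 < nwalks i x -> i <= t -> level x <= i.
Proof.
move=> wx it; rewrite leqNgt; apply/negP => /(before_find 0).
by rewrite nth_iota // add0n wx.
Qed.

Lemma nwalks_level x : level x <= t -> 0 < nwalks (level x) x.
Proof.
move=> lx; have hx : has (fun i => 0 < nwalks i x) (iota 0 t.+1).
  by rewrite has_find size_iota.
by have := nth_find 0 hx; rewrite -/(level x) nth_iota // add0n.
Qed.

Lemma level0 x : (level x == 0) = (x == v).
Proof. by rewrite /level /=; case: (x == v). Qed.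

Lemma nwalksS_gt0 x y i : adj x y -> 0 < nwalks i y -> 0 < nwalks i.+1 x.
Proof. by move=> xy wy; rewrite /= (bigD1 y) //= addn_gt0 wy. Qed.

Lemma level_adj x y : adj x y -> level x <= (level y).+1.
Proof.
move=> xy; have [yt|yt] := ltnP (level y) t; last first.
  by apply: leq_trans (level_max x) _.
by apply: level_leq => //; apply: nwalksS_gt0 xy (nwalks_level _); apply: ltnW.
Qed.

Definition back x := \sum_(y | adj x y && ((level y).+1 == level x)) 1.
Definition side x := \sum_(y | adj x y && (level y == level x)) 1.
Definition forth x := \sum_(y | adj x y && (level y == (level x).+1)) 1.

Lemma degree_level x : degree x = back x + side x + forth x.
Proof.
rewrite /degree -sum1dep_card (bigID (fun y => (level y).+1 == level x)) /=.
rewrite -addnA; congr (_ + _).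
rewrite (bigID (fun y => level y == level x)) /=; congr (_ + _).
  by apply: eq_bigl => y; case: (adj x y) => //=; lia.
apply: eq_bigl => y; case: (boolP (adj x y)) => //= xy.
have := level_adj xy; rewrite adj_sym in xy; have := level_adj xy; lia.
Qed.

Lemma nwalks_back i x : i < t -> level x = i.+1 ->
  nwalks i.+1 x = \sum_(y | adj x y && (level y == i)) nwalks i y.
Proof.
move=> it lx /=; rewrite big_mkcondr; apply: eq_bigr => y xy.
case: ifPn => // ly; apply/eqP; rewrite eqn0Ngt; apply/negP => wy.
have := level_leq wy (ltnW it); have := level_adj xy; lia.
Qed.

(** Some geodesic reaches [x], necessarily through a lower neighbour, and every lower neighbour
    contributes at least one. *)
Lemma back_leq x : 0 < level x <= t -> 0 < back x <= nwalks (level x) x.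
Proof.
case E: (level x) => [//|i] it; rewrite (nwalks_back it E) /back E.
have eqSb : (fun y => adj x y && ((level y).+1 == i.+1))
   =1 (fun y => adj x y && (level y == i)) by [].
rewrite (eq_bigl _ _ eqSb); apply/andP; split.
  have := @nwalks_level x; rewrite E => /(_ it).
  rewrite (nwalks_back it E) !lt0n; apply: contraNN.
  rewrite sum_nat_eq0 => /forallP H; apply/eqP/big1 => y Py.
  by have := H y; rewrite Py.
apply: leq_sum => y /andP[_ /eqP ly].
by rewrite -ly nwalks_level // ly ltnW.
Qed.

(** These are [T_i], [I_i] and [U_i]; an edge inside a level counts twice in [I_i]. *)
Definition paths i := \sum_(x | level x == i) nwalks i x.
Definition sides i := \sum_(x | level x == i) side x.
Definition forths i := \sum_(x | level x == i) forth x.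

Lemma forths_back i : forths i = \sum_(x | level x == i.+1) back x.
Proof.
rewrite /forths /back /forth.
rewrite (exchange_big_dep (fun y => level y == i.+1)) /=; last first.
  by move=> x y /eqP-> /andP[].
apply: eq_bigr => y /eqP ly; apply: eq_bigl => x.
by rewrite adj_sym ly [i.+1 == _]eq_sym eqSS andbCA andbb.
Qed.

Lemma paths_forth i : i < t ->
  paths i.+1 = \sum_(y | level y == i) nwalks i y * forth y.
Proof.
move=> it; rewrite /paths.
under eq_bigr => x /eqP lx do rewrite (nwalks_back it lx).
rewrite (exchange_big_dep (fun y => level y == i)) /=; last by move=> x y _ /andP[].
apply: eq_bigr => y /eqP ly; rewrite /forth big_distrr /=.
rewrite (eq_bigl (fun x => adj y x && (level x == (level y).+1))).
  by apply: eq_bigr => x _; rewrite muln1.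
by move=> x; rewrite adj_sym ly eqxx andbT andbC.
Qed.

Lemma forths_leq i : i < t -> forths i <= paths i.+1.
Proof.
move=> it; rewrite forths_back; apply: leq_sum => x /eqP lx.
by have := @back_leq x; rewrite lx => /(_ it) /andP[].
Qed.

Hypothesis deg_v : forall x : G, degree x <= degree v.

Lemma sides_paths i : 0 < i < t -> sides i + paths i.+1 <= (degree v).-1 * paths i.
Proof.
case/andP=> i0 it; rewrite paths_forth // /sides /paths -big_split /= big_distrr /=.
apply: leq_sum => x /eqP lx.
have := @back_leq x; rewrite lx i0 ltnW // => /(_ isT) /andP[b0 bw].
have := deg_v x; rewrite degree_level => dv.
have w0 := leq_trans b0 bw; set d := degree v in dv *.
move: b0 dv; clear -w0; move: (back x) (side x) (forth x) => b s f b0 dv.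
(* Sideways arcs may be multiplied by [nwalks i x], which is positive; at least one edge at [x] goes
   back. *)
rewrite mulnC; apply: (@leq_trans ((s + f) * nwalks i x)); nia.
Qed.

Definition inner_arcs k := \sum_(i < k) ((forths i).*2 + sides i).

(** In the induction, the term [2 T_(i+1)] pays for the new [2 U_i], and [I_(i+1) + 2 T_(i+2)] is at
    most [2 (d - 1) T_(i+1)], hence at most [2 (d - 1) d ^ (i + 1)]. *)
Lemma paths_leq i : i < t ->
  inner_arcs i + sides i + (paths i.+1).*2 <= (degree v ^ i.+1).*2.
Proof.
elim: i => [|i IHi] it.
  rewrite /inner_arcs big_ord0 add0n paths_forth // /sides.
  rewrite !(big_pred1 v level0) /=.
  rewrite expn1 eqxx mul1n; have := degree_level v.
  suff -> : side v = 0 by lia.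
  rewrite /side big1 // => y /andP[vy]; rewrite (_ : level v = 0); last first.
    by apply/eqP; rewrite level0.
  by rewrite level0 => /eqP yv; rewrite yv adj_irr in vy.
have /IHi IH := ltnW it; have := forths_leq (ltnW it).
have := @sides_paths i.+1 it; rewrite /inner_arcs big_ord_recr /= -/(inner_arcs i).
rewrite [degree v ^ i.+2]expnS.
case: (degree v) IH => [|d]; first by rewrite !exp0n //; lia.
move: (d.+1 ^ i.+1) (paths i.+1) (paths i.+2) => P p q.
move: (inner_arcs i) (forths i) (sides i) (sides i.+1) => C f s s' IH /= sq fp.
have : d * p.*2 <= d * P.*2 by rewrite leq_mul2l; lia.
lia.
Qed.

Definition outer_arcs k :=
  \sum_(x | k <= level x) \sum_(y | adj x y && (k <= level y)) 1.

(** Raising [k] by one removes from the outer arcs those inside level [k] and, in both directions,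
    those between levels [k] and [k + 1]. *)
Lemma arcs_split k : \sum_(x : G) degree x = inner_arcs k + outer_arcs k.
Proof.
elim: k => [|k IHk].
  rewrite /inner_arcs big_ord0 add0n; apply: eq_bigr => x _.
  by rewrite /degree -sum1dep_card; apply: eq_bigl => y; rewrite andbT.
rewrite IHk /inner_arcs big_ord_recr /= -addnA; congr (_ + _).
rewrite /outer_arcs (bigID (fun x => level x == k)) /=.
have -> : \sum_(x | (k <= level x) && (level x == k))
    \sum_(y | adj x y && (k <= level y)) 1 = sides k + forths k.
  rewrite /sides /forths -big_split /=; apply: eq_big => [x|x /andP[_ /eqP lx]].
    by lia.
  rewrite (bigID (fun y => level y == level x)) /= lx; congr (_ + _).
    by rewrite /side lx; apply: eq_bigl => y; case: (adj x y) => //=; lia.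
  rewrite /forth lx; apply: eq_bigl => y; case: (boolP (adj x y)) => //= xy.
  rewrite adj_sym in xy; have := level_adj xy; lia.
have -> : \sum_(x | (k <= level x) && (level x != k))
    \sum_(y | adj x y && (k <= level y)) 1 =
    \sum_(x | k < level x) \sum_(y | adj x y && (level y == k)) 1 +
    \sum_(x | k < level x) \sum_(y | adj x y && (k < level y)) 1.
  rewrite -big_split /=; apply: eq_big => [x|x _]; first lia.
  rewrite (bigID (fun y => level y == k)) /=; congr (_ + _).
    by apply: eq_bigl => y; case: (adj x y) => //=; lia.
  by apply: eq_bigl => y; case: (adj x y) => //=; lia.
suff -> : \sum_(x | k < level x) \sum_(y | adj x y && (level y == k)) 1 = forths k.
  by lia.
rewrite forths_back (bigID (fun x => level x == k.+1)) /=.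
rewrite [X in _ + X]big1 ?addn0 => [|x /andP[kx xk]]; last first.
  by apply: big1 => y /andP[xy /eqP yk]; have := level_adj xy; lia.
apply: eq_big => [x|x /andP[_ /eqP lx]]; first lia.
by apply: eq_bigl => y; rewrite lx eqSS.
Qed.

(** * Consequences of the diameter condition *)

Hypothesis t_gt0 : 0 < t.
Hypothesis diam : ele (diameter (line_graph G)) t.

(** This is the [p] of the weights; it vanishes at level [t.+1], where no geodesic of length [t]
    ends. *)
Definition ends x := if level x == t then nwalks t x else 0.

Lemma ends_adj x y :
  adj x y -> t <= level x -> t <= level y -> degree v <= ends x + ends y.
Proof.
move=> xy tx ty.
pose near z := [set u | adj v u && walk z u t.-1].
have nearP z : t <= level z -> #|near z| <= ends z.
  move=> tz; have := card_walk_nwalks z t.-1; rewrite prednK // => H.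
  apply: leq_trans H _; rewrite /ends; case: eqP => // /eqP nt.
  by rewrite leqNgt; apply/negP => w0; have := level_leq w0 (leqnn t); lia.
apply: leq_trans (leq_add (nearP x tx) (nearP y ty)).
apply: leq_trans (leq_card_setU _ _); apply/subset_leq_card/subsetP => u.
rewrite !inE => vu; rewrite vu /=.
have ee : [set x; y] \in edges G by apply/edgesP; exists x, y.
have ff : [set v; u] \in edges G by apply/edgesP; exists v, u.
have /ele_distP[k kt] := elimT (ele_diameterP _ _) 
  diam (exist (fun e => is_true (e \in edges G)) _ ee)
  (exist (fun e => is_true (e \in edges G)) _ ff).
have far z u' j : t <= level z -> adj v u' -> walk z u' j -> t.-1 <= j.
  move=> tz vu' zu'; rewrite leqNgt; apply/negP => jt.
  have : 0 < nwalks j.+1 z.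
    apply: leq_trans (card_walk_nwalks z j); apply/card_gt0P; exists u'.
    by rewrite inE vu'.
  by move=> /level_leq /(_ _); lia.
have nov z j : t <= level z -> walk z v j -> t <= j.
  move=> tz zv; rewrite leqNgt; apply/negP => jt.
  suff /level_leq : 0 < nwalks j z by move=> /(_ (ltnW jt)); lia.
  elim: j z {tz jt} zv => [|j IHj] z.
    by move/existsP=> [p]; rewrite (tuple0 p) /= => ->.
  by rewrite walkS => /existsP[z' /andP[zz' /IHj]]; apply: nwalksS_gt0.
(* Length 0 would identify the two edges, although [v] lies below level [t]. *)
case: k kt => [|k] kt.
  move/existsP=> [p]; rewrite (tuple0 p) /= => /eqP/(congr1 val)/= E.
  have : v \in [set x; y] by rewrite E !inE eqxx.
  have : level v = 0 by apply/eqP; rewrite level0.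
  by move=> lv; rewrite !inE => /orP[]/eqP E'; rewrite -E' lv in tx ty; lia.
move/line_walk_walk=> [j [a [b [jk /= ae bf ab]]]].
have ta : t <= level a by move: ae; rewrite !inE => /orP[]/eqP->.
(* The walk has at most [t.-1] steps, too few to reach [v]; so it ends in [u], and no shorter walk
   could. *)
move: bf; rewrite !inE => /orP[]/eqP Eb; rewrite {b}Eb in ab.
  by have := nov _ _ ta ab; lia.
have jt : j = t.-1 by have := far _ _ _ ta vu ab; lia.
by move: ae; rewrite !inE -jt => /orP[]/eqP <-; rewrite ab ?orbT.
Qed.

Definition back_ends x := if level x == t then back x else 0.

Lemma back_ends_leq x : back_ends x <= ends x.
Proof.
rewrite /back_ends /ends; case: eqP => // lx.
by have := @back_leq x; rewrite lx t_gt0 leqnn => /(_ isT) /andP[].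
Qed.

Lemma back_ends_outer x : t <= level x ->
  back_ends x + \sum_(y | adj x y && (t <= level y)) 1 <= degree v.
Proof.
move=> tx; apply: leq_trans (deg_v x); rewrite /degree -sum1dep_card.
rewrite [X in _ <= X](bigID (fun y => t <= level y)) /= addnC leq_add2l.
rewrite /back_ends; case: eqP => // lx; rewrite /back lx.
rewrite leq_eqVlt; apply/orP; left; apply/eqP/eq_bigl => y.
by case: (boolP (adj x y)) => //= xy; have := level_adj xy; lia.
Qed.

(** * Distributing weights over the outer edges *)

Local Open Scope ring_scope.

Definition weight x : rat :=
  (3 / 2 * (ends x)%:R - (back_ends x)%:R) / ((degree v)%:R - (back_ends x)%:R).

Lemma weight_outer x : (t <= level x)%N ->
  weight x * (\sum_(y | adj x y && (t <= level y)) 1)%N%:R <=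
  3 / 2 * (ends x)%:R - (back_ends x)%:R.
Proof.
move=> tx; have := back_ends_outer tx; move: (\sum_(_ | _) 1)%N => r.
have := back_ends_leq x; rewrite /weight -!(ler_nat rat) natrD.
move: (ends x)%:R (back_ends x)%:R (degree v)%:R (ler0n rat r) (ler0n rat (back_ends x)).
move: r%:R => {tx}r p b d r0 b0 bp br.
(* The denominator [d - b] can vanish only if no outer edge leaves [x]. *)
have [->|rn0] := eqVneq r 0; first by rewrite mulr0; lra.
have r_gt0 : 0 < r by rewrite lt0r rn0.
have db : 0 < d - b by lra.
by rewrite mulrAC ler_pdivrMr // ler_wpM2l; lra.
Qed.

Lemma weight_adj x y : adj x y -> (t <= level x)%N -> (t <= level y)%N ->
  1 <= weight x + weight y.
Proof.
move=> xy tx ty; have := ends_adj xy tx ty.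
have db u w : adj u w -> (t <= level u)%N -> (t <= level w)%N ->
    (back_ends u < degree v)%N.
  move=> uw tu tw; have := back_ends_outer tu.
  by rewrite (bigD1 w) ?uw //=; lia.
have := db _ _ xy tx ty; rewrite adj_sym in xy; have := db _ _ xy ty tx.
have := back_ends_leq x; have := back_ends_leq y.
rewrite /weight -!(ltr_nat rat) -!(ler_nat rat) natrD.
move: (ler0n rat (back_ends x)) (ler0n rat (back_ends y)).
by move=> *; apply: weight_sum.
Qed.

Lemma outer_arcs_leq : (outer_arcs t + (forths t.-1).*2 <= 3 * paths t)%N.
Proof.
have outerE : (outer_arcs t)%:R <=
    2 * \sum_(x | (t <= level x)%N) (3 / 2 * (ends x)%:R - (back_ends x)%:R) :> rat.
  apply: (@le_trans _ _ (\sum_(x | (t <= level x)%N)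
      \sum_(y | adj x y && (t <= level y)%N) (weight x + weight y))).
    rewrite /outer_arcs natr_sum; apply: ler_sum => x tx.
    rewrite natr_sum; apply: ler_sum => y /andP[xy ty].
    exact: weight_adj.
  under eq_bigr do rewrite big_split /=.
  rewrite big_split /= [X in _ + X](exchange_big_dep (fun y => (t <= level y)%N)) /=;
    last by move=> x y _ /andP[].
  (* Reversing arcs shows that both ends contribute the same total. *)
  have -> : \sum_(y | (t <= level y)%N)
      \sum_(x | (t <= level x)%N && (adj x y && (t <= level y)%N)) weight y =
      \sum_(x | (t <= level x)%N) \sum_(y | adj x y && (t <= level y)%N) weight x.
    apply: eq_bigr => y ty; apply: eq_bigl => x.
    by rewrite ty andbT adj_sym andbC.
  rewrite -[leLHS]mulr2n -[leLHS]mulr_natl ler_pM2l //; apply: ler_sum => x tx.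
  apply: le_trans (weight_outer tx).
  by rewrite natr_sum mulr_sumr; under [leRHS]eq_bigr do rewrite mulr1.
rewrite -(ler_nat rat) natrD natrM; move: outerE.
rewrite sumrB -mulr_sumr -!natr_sum.
have -> : (\sum_(x | t <= level x) ends x = paths t)%N.
  rewrite /paths /ends -big_mkcondr; apply: eq_bigl => x; lia.
have -> : (\sum_(x | t <= level x) back_ends x = forths t.-1)%N.
  rewrite forths_back prednK // /back_ends -big_mkcondr.
  by apply: eq_bigl => x; lia.
rewrite -addnn natrD; lra.
Qed.

(** Adding [inner_arcs t.-1 + I_(t-1) + 2 T_t <= 2 d ^ t] to the bound [3 T_t] on the remaining arcs
    leaves an excess [T_t], itself at most [d ^ t]. *)
Lemma sum_degree_leq : (\sum_(x : G) degree x <= 3 * degree v ^ t)%N.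
Proof.
have -> : (\sum_(x : G) degree x =
    inner_arcs t.-1 + sides t.-1 + (forths t.-1).*2 + outer_arcs t)%N.
  rewrite (arcs_split t) -{1}(prednK t_gt0) /inner_arcs big_ord_recr /=; lia.
have := @paths_leq t.-1; rewrite prednK // leqnn => /(_ isT).
have := outer_arcs_leq; lia.
Qed.

End Levels.

Theorem theorem6 (t D : nat) (ht : (1 <= t)%N) (hD : (1 <= D)%N) :
  (h t D)%:R <= 3 / 2 * D%:R ^+ t + 1 :> rat.
Proof.
have [[G [/andP[degD diam] cardE]] _] := h_spec t D.
suff : ((h t D).-1.*2 <= 3 * D ^ t)%N.
  by rewrite -(ler_nat rat) -natrX -addnn /h /= -natr1 natrD natrM; lra.
rewrite -cardE -sum_degree.
(* A vertex [v] of maximum degree exists only in a nonempty graph. *)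
have [/card0_eq G0|G_gt0] := posnP #|G|; first by rewrite big_pred0.
have [v vmax] := bigop.eq_bigmax (@degree G) G_gt0.
have deg_v (x : G) : (degree x <= degree v)%N by rewrite -vmax bigop.leq_bigmax.
apply: leq_trans (sum_degree_leq deg_v ht diam) _.
by rewrite leq_mul2l leq_exp2r // -vmax.
Qed.
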